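(* Let $(X,d)$ be a complete Busemann convex space that is additionally $\delta$-hyperbolic (for some $\delta\ge 0$), and let $A\subseteq X$ be closed and convex. Let $\lambda\ge 1$ and let $M=M(\delta,\lambda)\ge 0$ be a constant, depending only on $\delta$ and $\lambda$, such that in every $\delta$-hyperbolic geodesic space all $\lambda$-quasi-geodesic triangles are $M$-slim. If $A$ contains a $k$-local $\lambda$-quasi-geodesic ray with $k>8\lambda M$, then $A$ contains a geodesic ray.
   Context: A geodesic joining $x$ and $y$ in a metric space $(X,d)$ is a map $\gamma:[a,b]\to X$ with $\gamma(a)=x$, $\gamma(b)=y$ and $d(\gamma(s),\gamma(t))=|s-t|$ for all $s,t$; its image is a geodesic segment. A geodesic space is one in which every two points are joined by a geodesic segment. A subset of a geodesic space is convex if it contains every geodesic segment joining two of its points. A geodesic ray is (the image of) a map $\gamma:[0,\infty)\to X$ with $d(\gamma(s),\gamma(t))=|s-t|$ for all $s,t\ge0$. A geodesic space $X$ is Busemann convex if for any two geodesics $\gamma:[a,b]\to X$, $\sigma:[c,e]\to X$ and all $t\in[0,1]$, $d(\gamma((1-t)a+tb),\sigma((1-t)c+te))\le(1-t)d(\gamma(a),\sigma(c))+t\,d(\gamma(b),\sigma(e))$. A geodesic space is $\delta$-hyperbolic if every side of every geodesic triangle is contained in the $\delta$-neighborhood of the union of the other two sides. For $\lambda\ge1$, $\varepsilon\ge0$, a $(\lambda,\varepsilon)$-quasi-geodesic is a map $\gamma:[a,b]\to X$ such that $\frac1\lambda|s-t|-\varepsilon\le d(\gamma(s),\gamma(t))\le\lambda|s-t|+\varepsilon$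 ( * ) for all $s,t\in[a,b]$; it joins $\gamma(a)$ and $\gamma(b)$. A $\lambda$-quasi-geodesic is a map that is a $(\lambda,\varepsilon)$-quasi-geodesic for every $\varepsilon>0$ (equivalently, ( * ) holds with $\varepsilon=0$). With $[0,\infty)$ in place of $[a,b]$ one speaks of quasi-geodesic rays (the map or its image). For $k>0$, the $k$-local versions require ( * ) only for $s,t$ with $|s-t|\le k$; thus a $k$-local $\lambda$-quasi-geodesic ray is a map $\gamma:[0,\infty)\to X$ with $\frac1\lambda|s-t|\le d(\gamma(s),\gamma(t))\le\lambda|s-t|$ whenever $|s-t|\le k$. A $\lambda$-quasi-geodesic triangle consists of three points (vertices) and the images of three $\lambda$-quasi-geodesics (sides) joining each pair of vertices; it is $M$-slim if each side is contained in the $M$-neighborhood of the union of the other two sides. It is a known fact (Bridson-Haefliger) that a constant $M(\delta,\lambda)$ as in the claim exists for all $\delta\ge0$, $\lambda\ge1$. *)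

(* Defs.v *)
From HB Require Import structures.
From mathcomp Require Import all_boot all_order all_algebra.
From mathcomp Require Import all_classical all_reals all_analysis.

Set Implicit Arguments.
Unset Strict Implicit.
Unset Printing Implicit Defensive.

Import Order.TTheory GRing.Theory Num.Theory.
Import numFieldNormedType.Exports.

Local Open Scope classical_set_scope.
Local Open Scope ring_scope.

(* The base point that [Complete] carries is harmless: it only rules out the
   empty space, which contains no ray. *)
#[short(type="completeMetricType")]
HB.structure Definition CompleteMetric (R : realType) :=
  { T of Complete T & Metric R T }.

(* A map on [a, b] (resp. [0, +oo[) is represented by a total function R -> X
   whose values outside the interval are unconstrained and never used. *)

Section metric_geometry.
Context {R : realType} {X : metricType R}.
Implicit Types (gamma : R -> X) (x y z : X) (A S : set X).

Definition geodesic (a b : R) gamma :=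
  a <= b /\
  {in `[a, b] &, forall s t, mdist (gamma s) (gamma t) = `|s - t|}.

Definition joins (a b : R) gamma x y := gamma a = x /\ gamma b = y.

Definition geodesic_segment x y S :=
  exists a b gamma,
    [/\ geodesic a b gamma, joins a b gamma x y & S = gamma @` `[a, b] ].

Definition geodesically_convex A :=
  forall x y S, A x -> A y -> geodesic_segment x y S -> S `<=` A.

Definition geodesic_ray gamma :=
  {in `[0, +oo[ &, forall s t, mdist (gamma s) (gamma t) = `|s - t|}.

Definition ray_image gamma : set X := gamma @` `[0, +oo[.

Definition qi_bounds (lambda eps : R) gamma (s t : R) :=
  lambda^-1 * `|s - t| - eps <= mdist (gamma s) (gamma t)
    <= lambda * `|s - t| + eps.

Definition quasi_geodesic (lambda eps a b : R) gamma :=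
  a <= b /\ {in `[a, b] &, forall s t, qi_bounds lambda eps gamma s t}.

Definition lambda_quasi_geodesic (lambda a b : R) gamma :=
  forall eps, 0 < eps -> quasi_geodesic lambda eps a b gamma.

Definition local_quasi_geodesic_ray (k lambda : R) gamma :=
  {in `[0, +oo[ &, forall s t, `|s - t| <= k -> qi_bounds lambda 0 gamma s t}.

Definition quasi_geodesic_side (lambda : R) x y S :=
  exists a b gamma,
    [/\ lambda_quasi_geodesic lambda a b gamma, joins a b gamma x y
      & S = gamma @` `[a, b] ].

(* Closed neighborhoods, so that 0-hyperbolicity is a meaningful notion.
   All the sides considered below are compact, so for them this is the set of
   points at distance at most r from S. *)
Definition neighborhood (r : R) S : set X :=
  [set x | exists2 y, S y & mdist x y <= r].

Definition slim (M : R) (S1 S2 S3 : set X) :=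
  [/\ S1 `<=` neighborhood M (S2 `|` S3),
      S2 `<=` neighborhood M (S3 `|` S1)
    & S3 `<=` neighborhood M (S1 `|` S2) ].

End metric_geometry.

Section metric_spaces.
Context {R : realType} (X : metricType R).

Definition geodesic_space :=
  forall x y : X, exists S, geodesic_segment x y S.

Definition busemann_convex :=
  geodesic_space /\
  forall (a b c e : R) (gamma sigma : R -> X),
    geodesic a b gamma -> geodesic c e sigma ->
    forall t, 0 <= t <= 1 ->
      mdist (gamma ((1 - t) * a + t * b)) (sigma ((1 - t) * c + t * e))
        <= (1 - t) * mdist (gamma a) (sigma c) + t * mdist (gamma b) (sigma e).

Definition hyperbolic (delta : R) :=
  geodesic_space /\
  forall (x y z : X) S1 S2 S3,
    geodesic_segment x y S1 -> geodesic_segment y z S2 ->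
    geodesic_segment z x S3 -> slim delta S1 S2 S3.

Definition quasi_geodesic_triangles_slim (lambda M : R) :=
  forall (x y z : X) S1 S2 S3,
    quasi_geodesic_side lambda x y S1 -> quasi_geodesic_side lambda y z S2 ->
    quasi_geodesic_side lambda z x S3 -> slim M S1 S2 S3.

End metric_spaces.

(* Main.v *)
Require Import Defs.
From mathcomp Require Import all_boot all_order all_algebra.
From mathcomp Require Import all_classical all_reals all_analysis.
From mathcomp Require Import ring lra.

Import Order.TTheory GRing.Theory Num.Theory.
Import numFieldNormedType.Exports.

Local Open Scope classical_set_scope.
Local Open Scope ring_scope.

(* Let gamma be the local quasi-geodesic ray and p = gamma 0.

   Any subarc of gamma lies within 2M of a geodesic with the same endpoints:
   if it lies within r, then applying slimness to the quadrilateral spanned by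
   a subarc of length at most k around gamma s and two points of the geodesic
   within r of its ends shows that it lies within max (2M, r - eta), where
   eta = k / (2 lambda) - 4M > 0.

   Consequently gamma is unbounded. If T <= T', the geodesic from p to gamma T'
   passes within 2M of gamma T, so by Busemann convexity its point at distance
   s from p is within 4Ms / d(p, gamma T) of the corresponding point of the
   geodesic from p to gamma T. Geodesics in A from p to points of gamma going to
   infinity therefore converge pointwise, and the limit is a ray in A. *)

(** * Geodesic segments and their reparametrisations *)

Section geodesics.
Context {R : realType} {X : metricType R}.
Implicit Types (x y z w : X) (S : set X) (g : R -> X).

Lemma geodesic_dist {a b g s t} : geodesic a b g ->
  a <= s -> s <= t -> t <= b -> mdist (g s) (g t) = t - s.
Proof.
move=> [_ gE] as_ st tb; rewrite gE ?in_itv/=; last 2 first.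
- by rewrite as_ (le_trans st tb).
- by rewrite tb (le_trans as_ st).
by rewrite distrC ger0_norm// subr_ge0.
Qed.

Lemma geodesic_segment_between {x y S w} :
  geodesic_segment x y S -> S w -> mdist x w + mdist w y = mdist x y.
Proof.
move=> [a [b [g [gg [<- <-] ->]]]] [u /=]; rewrite in_itv/= => /andP[au ub] <-.
by rewrite !(geodesic_dist gg)// ?(le_trans au)//; lra.
Qed.

Lemma geodesic_segment_endpoints {x y S} : geodesic_segment x y S -> S x /\ S y.
Proof.
move=> [a [b [g [[ab _] [<- <-] ->]]]].
by split; [exists a|exists b]; rewrite //= in_itv/= lexx ab.
Qed.

Lemma geodesic_segment_sym {x y S} :
  geodesic_segment x y S -> geodesic_segment y x S.
Proof.
move=> [a [b [g [[ab gE] [gx gy] ->]]]].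
exists a, b, (fun t => g (a + b - t)); split.
- split=> // s t; rewrite !in_itv/= => /andP[? ?] /andP[? ?].
  rewrite gE ?in_itv/=; [|lra|lra].
  by rewrite distrC; congr `|_|; lra.
- by split; rewrite -?gx -?gy; congr g; lra.
- apply/seteqP; split=> v [u /=]; rewrite in_itv/= => ? <-.
  + by exists (a + b - u); [rewrite /= in_itv/=; lra|congr g; lra].
  + by exists (a + b - u); [rewrite /= in_itv/=; lra|].
Qed.

Lemma geodesic_subsegment {x y S w w'} : geodesic_segment x y S ->
  S w -> S w' -> exists2 S', geodesic_segment w w' S' & S' `<=` S.
Proof.
move=> [a [b [g [[ab gE] _ ->]]]] [u /=]; rewrite in_itv/= => uab <-.
move=> [v /=]; rewrite in_itv/= => vab <-.
wlog uv : u v uab vab / u <= v => [H|].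
  have [/H|/ltW/H] := leP u v; first exact.
  by move=> /(_ vab uab) [S' /geodesic_segment_sym S'vu S'S]; exists S'.
exists (g @` `[u, v]).
  exists u, v, g; split=> //; split=> // s t.
  rewrite !in_itv/= => ? ?; apply: gE; rewrite in_itv/=; lra.
move=> v' [s /=]; rewrite in_itv/= => ? <-.
by exists s; rewrite //= in_itv/=; lra.
Qed.

Lemma exists_geodesic (x y : X) : geodesic_space X ->
  exists g, geodesic 0 (mdist x y) g /\ joins 0 (mdist x y) g x y.
Proof.
move=> /(_ x y) [_ [a [b [g [gg [gx gy] _]]]]].
have ab := gg.1.
have -> : mdist x y = b - a by rewrite -gx -gy (geodesic_dist gg).
exists (fun t => g (a + t)); split; last first.
  by split; rewrite -?gx -?gy; congr g; lra.
split=> [|s t]; first lra.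
rewrite !in_itv/= => ? ?; rewrite gg.2 ?in_itv/=; [|lra|lra].
by congr `|_|; lra.
Qed.

Lemma geodesic_segment_quasi {lambda x y S} : 1 <= lambda ->
  geodesic_segment x y S -> quasi_geodesic_side lambda x y S.
Proof.
move=> l1 [a [b [g [[ab gE] gxy ->]]]]; exists a, b, g; split=> // e e0.
split=> // s t sab tab; rewrite /qi_bounds gE//.
have n0 := normr_ge0 (s - t).
apply/andP; split; last by nra.
have : lambda^-1 * `|s - t| <= `|s - t|; last lra.
by rewrite ler_piMl// invf_le1//; lra.
Qed.

Lemma mdist_le_abs x y z : `|mdist x z - mdist y z| <= mdist x y.
Proof.
have := metric_triangle x y z; have := metric_triangle y x z.
by rewrite (metric_sym y x) ler_norml; lra.
Qed.

End geodesics.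

(** * Local quasi-geodesic rays under slim quasi-geodesic triangles *)

Section tracking.
Context {R : realType} {X : metricType R} {lambda M k : R}.
Context (geoX : geodesic_space X) (lambda1 : 1 <= lambda) (M0 : 0 <= M).
Context (slimX : quasi_geodesic_triangles_slim X lambda M).
Context (kM : 8 * lambda * M < k).
Implicit Types (x y z w : X) (S : set X) (g : R -> X).

(** A diagonal [D] from [z'] to [y] cuts the quadrilateral into two triangles, and crossing each of
    them costs [M]. *)
Lemma quadrilateral_slim {y z y' z' Q Sy Sz S x} :
  quasi_geodesic_side lambda y z Q ->
  geodesic_segment y y' Sy -> geodesic_segment z z' Sz ->
  geodesic_segment y' z' S ->
  Q x -> exists2 w, Sy w \/ Sz w \/ S w & mdist x w <= 2 * M.
Proof.
move=> qQ gy gz gS Qx; have [D gD] := geoX z' y.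
have q := fun x y S => @geodesic_segment_quasi R X lambda x y S lambda1.
have [/(_ _ Qx) + _ _] := slimX _ _ _ _ _ _ qQ (q _ _ _ gz) (q _ _ _ gD).
move=> [w [Szw|Dw] xw].
  by exists w; [right; left|move: M0; lra].
have [/(_ _ Dw) + _ _] :=
  slimX _ _ _ _ _ _ (q _ _ _ gD) (q _ _ _ gy) (q _ _ _ gS).
move=> [v Sv wv]; exists v; first by case: Sv; [left|right; right].
by have := metric_triangle x w v; lra.
Qed.

Let lambda0 : 0 < lambda. Proof. exact: lt_le_trans lambda1. Qed.

Let k0 : 0 < k. Proof. by move: M0 lambda0 kM => *; nra. Qed.

Let kM' : 8 * M < lambda^-1 * k.
Proof. by rewrite ltr_pdivlMl// (le_lt_trans _ kM)// mulrA (mulrC lambda). Qed.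

Context {gamma : R -> X}.
Context (gammaP : local_quasi_geodesic_ray k lambda gamma).

Lemma local_lower_bound {s t} : 0 <= s -> s <= t -> t <= s + k ->
  lambda^-1 * (t - s) <= mdist (gamma s) (gamma t).
Proof.
move=> s0 st tsk; have := gammaP s t; rewrite !in_itv/= !andbT => /(_ s0).
rewrite /qi_bounds distrC ger0_norm ?subr_ge0// subr0 addr0.
by move=> /(_ ltac:(lra) ltac:(lra)) /andP[].
Qed.

Lemma local_upper_bound {s t} : 0 <= s -> s <= t -> t <= s + k ->
  mdist (gamma s) (gamma t) <= lambda * (t - s).
Proof.
move=> s0 st tsk; have := gammaP s t; rewrite !in_itv/= !andbT => /(_ s0).
rewrite /qi_bounds distrC ger0_norm ?subr_ge0// subr0 addr0.
by move=> /(_ ltac:(lra) ltac:(lra)) /andP[].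
Qed.

Lemma local_quasi_side {s t} : 0 <= s -> s <= t -> t <= s + k ->
  quasi_geodesic_side lambda (gamma s) (gamma t) (gamma @` `[s, t]).
Proof.
move=> s0 st tsk; exists s, t, gamma; split=> // e e0; split=> // u v.
rewrite !in_itv/= => ? ?; have := gammaP u v; rewrite !in_itv/= !andbT.
move=> /(_ ltac:(lra) ltac:(lra)); rewrite /qi_bounds subr0 addr0.
have uvk : `|u - v| <= k by rewrite ler_norml; lra.
by move=> /(_ uvk) /andP[? ?]; apply/andP; split; lra.
Qed.

(** Chains [n] arcs of length at most [k]. This crude bound supplies the finite initial radius of
    the tube. *)
Lemma locally_bounded n t : 0 <= t <= n%:R * k ->
  mdist (gamma 0) (gamma t) <= n%:R * (lambda * k).
Proof.
elim: n t => [|n IHn] t.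
  by rewrite !mul0r => t0; have -> : t = 0 by [lra]; rewrite mdistxx.
rewrite -natr1 => t0; have [|tk] := leP t (n%:R * k).
  move=> ?; have := IHn t; have : 0 < lambda * k by rewrite mulr_gt0.
  by move=> ? /(_ ltac:(lra)); lra.
have n0 : 0 <= n%:R * k by rewrite mulr_ge0// ltW.
have := metric_triangle (gamma 0) (gamma (n%:R * k)) (gamma t).
have := IHn (n%:R * k) ltac:(lra).
have := @local_upper_bound (n%:R * k) t n0 (ltW tk) ltac:(lra).
have : lambda * (t - n%:R * k) <= lambda * k by rewrite ler_pM2l//; lra.
lra.
Qed.

(** * Subarcs stay within [2 * M] of geodesics *)

Section tube.
Context {a b : R} {S : set X} (a0 : 0 <= a).
Context (gS : geodesic_segment (gamma a) (gamma b) S).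

Let near r := forall s, a <= s <= b -> exists2 w, S w & mdist (gamma s) w <= r.

Let eta := lambda^-1 * (k / 2) - 4 * M.

(* If [w] lies on a geodesic from [gamma e] to [e'], a point of [S] at distance
   at most [r], then [mdist (gamma s) e'] falls below [r] by the excess of
   [mdist (gamma e) (gamma s)] over [2 * mdist (gamma s) w <= 4 * M]. *)
Lemma tube_corner {r s e} : near r -> a <= s <= b -> a <= e <= b ->
  S (gamma e) \/ lambda^-1 * (k / 2) <= mdist (gamma e) (gamma s) ->
  exists e' Se, [/\ S e', geodesic_segment (gamma e) e' Se &
    forall w, Se w -> mdist (gamma s) w <= 2 * M ->
      exists2 v, S v & mdist (gamma s) v <= Num.max (2 * M) (r - eta)].
Proof.
(* If [gamma e] is on [S], the side degenerates to that single point. *)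
move=> near_r sab eab [Se|far].
  have [T gT] := geoX (gamma e) (gamma e); exists (gamma e), T; split=> // w Tw.
  have := geodesic_segment_between gT Tw; rewrite mdistxx => ew.
  have -> : w = gamma e.
    apply/esym/mdist_positivity.
    have := mdist_ge0 w (gamma e); have := mdist_ge0 (gamma e) w; lra.
  by move=> sw; exists (gamma e); rewrite // le_max sw.
have [e' Se' ee'] := near_r _ eab; have [T gT] := geoX (gamma e) e'.
exists e', T; split=> // w Tw sw; exists e' => //.
rewrite le_max; apply/orP; right; rewrite /eta.
have := geodesic_segment_between gT Tw.
have := metric_triangle (gamma s) w e'.
have := metric_triangle (gamma e) w (gamma s); rewrite (metric_sym w (gamma s)).
lra.
Qed.

(** Slimness is applied to the quadrilateral on the subarc from [y] to [z] around [s], each end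
    being [k / 2] away in parameter or cut off at [a] or [b]. The total length is at most [k], so
    the subarc is a genuine quasi-geodesic. [tube_corner] treats the two lateral sides; the
    remaining side lies in [S]. *)
Lemma tube_step {r} : near r -> near (Num.max (2 * M) (r - eta)).
Proof.
move=> near_r s sab.
have [Sa Sb] := geodesic_segment_endpoints gS.
have [y [yab ys ysk yP]] : exists y : R,
    [/\ a <= y <= b, y <= s, s <= y + k / 2 &
    S (gamma y) \/ lambda^-1 * (k / 2) <= mdist (gamma y) (gamma s)].
  have [kpos apos] := (k0, a0); have [h|h] := leP a (s - k / 2).
    exists (s - k / 2); split; try lra; right.
    by rewrite (le_trans _ (local_lower_bound _ _ _))
      ?ler_pM2l ?invr_gt0//; lra.
  by exists a; split; try lra; left.
have [z [zab sz zsk zP]] : exists z : R,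
    [/\ a <= z <= b, s <= z, z <= s + k / 2 &
    S (gamma z) \/ lambda^-1 * (k / 2) <= mdist (gamma z) (gamma s)].
  have [kpos apos] := (k0, a0); have [h|h] := leP (s + k / 2) b.
    exists (s + k / 2); split; try lra; right; rewrite metric_sym.
    by rewrite (le_trans _ (local_lower_bound _ _ _))
      ?ler_pM2l ?invr_gt0//; lra.
  by exists b; split; try lra; left.
have [y' [Sy [Sy' gSy Hy]]] := tube_corner near_r sab yab yP.
have [z' [Sz [Sz' gSz Hz]]] := tube_corner near_r sab zab zP.
have [T gT TS] := geodesic_subsegment gS Sy' Sz'.
have Qs : (gamma @` `[y, z]) (gamma s) by exists s; rewrite //= in_itv/= ys.
have y0 : 0 <= y by move: a0; lra.
have yz : y <= z by lra.
have zk : z <= y + k by lra.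
have qQ := local_quasi_side y0 yz zk.
have [w [Syw|[Szw|Tw]] sw] := quadrilateral_slim qQ gSy gSz gT Qs.
- exact: Hy sw.
- exact: Hz sw.
- by exists w; [exact: TS|rewrite le_max sw].
Qed.

(* The contraction of [tube_step] replaces the usual choice of a point of the
   path at maximal distance from [S]. *)
Lemma local_quasi_geodesic_tube s : a <= s <= b ->
  exists2 w, S w & mdist (gamma s) w <= 2 * M.
Proof.
have eta0 : 0 < eta by rewrite /eta; move: kM'; lra.
have [r near_r] : exists r, near r.
  (* As [b <= n * k], both [gamma a] and [gamma t] are within [n * (lambda * k)] of [gamma 0]. *)
  pose n := (Num.truncn (b / k)).+1.
  have bn : b <= n%:R * k by rewrite -ler_pdivrMr// ltW// truncnS_gt.
  exists (n%:R * (lambda * k) + n%:R * (lambda * k)) => t tab.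
  exists (gamma a); first exact: (geodesic_segment_endpoints gS).1.
  rewrite (le_trans (metric_triangle _ (gamma 0) _))// metric_sym.
  by rewrite lerD// locally_bounded//; move: a0; lra.
have nearn n : near (Num.max (2 * M) (r - n%:R * eta)).
  elim: n => [|n IHn] t tab.
    have [w Sw tw] := near_r t tab; exists w => //.
    by rewrite le_max mul0r subr0 tw orbT.
  have [w Sw tw] := tube_step IHn t tab; exists w => //; move: tw.
  rewrite !le_max => /orP[->//|]; rewrite lerBrDr le_max => /orP[|] tw.
    by apply/orP; left; lra.
  by apply/orP; right; rewrite -natr1; lra.
(* After this many steps [r - n * eta] is negative, so the maximum is [2 * M]. *)
move=> /(nearn (Num.truncn (r / eta)).+1) [w Sw sw]; exists w => //.
rewrite (le_trans sw)// ge_max lexx/=.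
have : r < (Num.truncn (r / eta)).+1%:R * eta.
  by rewrite -ltr_pdivrMr// truncnS_gt.
by move: M0; lra.
Qed.

End tube.

(** * Escape of the ray to infinity *)

Let p := gamma 0.

(** The geodesic from [gamma s] to [gamma t] passes within [2 * M] of [gamma (s + k)], which is at
    least [k / lambda] away from [gamma s]. *)
Lemma local_quasi_geodesic_separated {s t} : 0 <= s -> s + k <= t ->
  lambda^-1 * k - 2 * M <= mdist (gamma s) (gamma t).
Proof.
move=> s0 skt; have kpos := k0; have [S gS] := geoX (gamma s) (gamma t).
have [w Sw sw] := local_quasi_geodesic_tube s0 gS (s + k) ltac:(lra).
have := geodesic_segment_between gS Sw; have := mdist_ge0 w (gamma t).
have := metric_triangle (gamma s) w (gamma (s + k)).
have := @local_lower_bound s (s + k) s0 ltac:(lra) ltac:(lra).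
rewrite (metric_sym w (gamma _)) addrAC subrr add0r; lra.
Qed.

(* Points [gamma (i * k)] are far apart, so the points of a geodesic that
   track them are separated too, and a bounded geodesic holds few of them. *)
Lemma local_quasi_geodesic_unbounded B :
  exists2 T, 0 <= T & B <= mdist p (gamma T).
Proof.
apply/not_exists2P => bounded.
have {}bounded T : 0 <= T -> mdist p (gamma T) < B.
  by move=> T0; have [//|/negP] := bounded T; rewrite -ltNge.
(* The separation [k / lambda - 2 * M], less [2 * M] for projecting each of the two points to the
   geodesic. *)
pose c := lambda^-1 * k - 6 * M.
have c0 : 0 < c by rewrite /c; move: kM' M0; lra.
pose N := (Num.truncn (B / c)).+1.
have kn0 n : 0 <= n%:R * k by rewrite mulr_ge0// ltW.
pose L := mdist p (gamma (N%:R * k)).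
have LB : L < B by exact: bounded.
have [g [gg gj]] := exists_geodesic p (gamma (N%:R * k)) geoX.
have gS : geodesic_segment p (gamma (N%:R * k)) (g @` `[0, L]).
  by exists 0, L, g.
have /choice[u uP] : forall i : 'I_N.+1, exists u, 0 <= u <= L /\
    mdist (gamma (i%:R * k)) (g u) <= 2 * M.
  move=> i; have iN : 0 <= i%:R * k <= N%:R * k.
    by rewrite kn0 ler_pM2r// ler_nat -ltnS ltn_ord.
  have [_ [u /= + <-] iu] := local_quasi_geodesic_tube (lexx 0) gS _ iN.
  by rewrite in_itv/= => uL; exists u.
have u0 i : 0 <= u i / c.
  rewrite divr_ge0// ?(ltW c0)//.
  by have [/andP[]] := uP i.
have truncN i : (Num.truncn (u i / c) < N)%N.
  rewrite ltnS le_truncn// ler_pM2r ?invr_gt0// ltW//.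
  by have [/andP[_ uL] _] := uP i; exact: le_lt_trans uL LB.
(* Pigeonhole: [[0, L]] meets at most [N] cells of length [c], and [f i] is the cell of [u i]. Two
   of the [N + 1] parameters in one cell would differ by less than [c]. *)
pose f i := Ordinal (truncN i).
have: injective f.
  move=> i j /(congr1 val) /= fij; apply/eqP/contraT => ij.
  wlog lt_ij : i j fij ij / (i < j)%N => [H|].
    by move: (ij); rewrite neq_ltn => /orP[/H|/H]; apply=> //; rewrite eq_sym.
  have ijk : i%:R * k + k <= j%:R * k.
    by rewrite -[X in _ + X]mul1r -mulrDl ler_pM2r// natr1 ler_nat.
  have := local_quasi_geodesic_separated (kn0 i) ijk.
  have [_ ui] := uP i; have [_ uj] := uP j.
  have := metric_triangle (gamma (i%:R * k)) (g (u i)) (gamma (j%:R * k)).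
  have := metric_triangle (g (u i)) (g (u j)) (gamma (j%:R * k)).
  rewrite (metric_sym (g (u j)) (gamma _)) => gu ug sep.
  have uij : c <= `|u i - u j|.
    rewrite -(gg.2 (u i) (u j)) ?in_itv/=; [|exact: (uP i).1|exact: (uP j).1].
    by rewrite /c; lra.
  have : `|u i - u j| < c.
    have := truncn_itv (u0 i); have := truncn_itv (u0 j); rewrite fij -natr1.
    rewrite !ler_pdivlMr// !ltr_pdivrMr// mulrDl mul1r ltr_norml; lra.
  by rewrite ltNge uij.
by move=> /leq_card; rewrite !card_ord ltnn.
Qed.

(** * Comparison of geodesics from [p] by Busemann convexity *)

Context (busX : busemann_convex X).

Lemma geodesics_to_ray_close {T T' L L' s} {g g' : R -> X} :
  0 <= T -> T <= T' ->
  geodesic 0 L g -> joins 0 L g p (gamma T) ->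
  geodesic 0 L' g' -> joins 0 L' g' p (gamma T') ->
  0 < L -> 0 <= s -> s <= L -> s <= L' ->
  mdist (g s) (g' s) <= 4 * M * s / L.
Proof.
move=> T0 TT' gg [g0 gL] gg' [g'0 g'L] L0 s0 sL sL'.
have gS : geodesic_segment p (gamma T') (g' @` `[0, L']) by exists 0, L', g'.
have [_ [u /= + <-] Tu] :=
  local_quasi_geodesic_tube (lexx 0) gS T ltac:(by apply/andP).
rewrite in_itv/= => /andP[u0 uL'].
(* [u] and [L] are the distances from [p] to [g' u] and to [gamma T]. *)
have Lu : `|u - L| <= 2 * M.
  rewrite (le_trans _ Tu)// metric_sym (le_trans _ (mdist_le_abs _ _ p))//.
  rewrite -{1}g'0 -g0 -gL metric_sym (geodesic_dist gg')//.
  by rewrite metric_sym (geodesic_dist gg) ?subr0// ltW.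
pose t := s / L.
have tE : t * L = s by rewrite /t divfK// gt_eqF.
have t0 : 0 <= t by rewrite divr_ge0// ltW.
have t1 : t <= 1 by rewrite ler_pdivrMr// mul1r.
have gu : geodesic 0 u g'.
  split=> // v w; rewrite !in_itv/= => ? ?; apply: gg'.2; rewrite in_itv/=; lra.
(* Convexity is used with [g'] cut at [u], giving an error [t * (2 * M)] at [g' (t * u)]; moving on
   to [g' s] costs [t * |u - L|], again at most [t * (2 * M)]. *)
have := busX.2 _ _ _ _ _ _ gg gu t ltac:(by apply/andP).
rewrite g0 g'0 mdistxx !mulr0 !add0r tE gL => st.
have tu : 0 <= t * u by rewrite mulr_ge0.
have tuL' : t * u <= L' by rewrite (le_trans _ uL')// ler_piMl.
have := gg'.2 (t * u) s; rewrite !in_itv/= tu tuL' s0 sL' => /(_ isT isT).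
rewrite -{2}tE -mulrBr normrM (ger0_norm t0) => us.
rewrite (le_trans (metric_triangle _ (g' (t * u)) _))// us.
rewrite (_ : 4 * M * s / L = t * (2 * M) + t * (2 * M));
  last by rewrite /t; ring.
by apply: lerD; rewrite ?(le_trans st) ?ler_wpM2l.
Qed.

End tracking.

(** * Limits of sequences of points *)

Lemma mdist_cvg_eventually {R : realType} {X : metricType R} {u v : nat -> X}
    {x y : X} {c : R} :
  u @ \oo --> x -> v @ \oo --> y ->
  (\forall n \near \oo, mdist (u n) (v n) = c) -> mdist x y = c.
Proof.
move=> /cvg_ballP ux /cvg_ballP vy uvc.
apply/eqP; rewrite -subr_eq0 -normr_le0; apply/ler_addgt0Pl => e e0.
have e2 : 0 < e / 2 by rewrite divr_gt0.
near \oo => n.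
have <- : mdist (u n) (v n) = c by near: n.
have : ball x (e / 2) (u n) by near: n; exact: ux.
have : ball y (e / 2) (v n) by near: n; exact: vy.
rewrite !ballEmdist/= addr0 => yv xu.
have := mdist_le_abs x (u n) y; have := mdist_le_abs y (v n) (u n).
rewrite (metric_sym (v n)) (metric_sym y (u n)) !ler_norml; lra.
Unshelve. all: by end_near. Qed.

Lemma harmonic_cauchy_cvg {R : realType} {X : completeMetricType R}
    {u : nat -> X} {C : R} {N0 : nat} :
  (forall N n m, (N0 <= N)%N -> (N <= n)%N -> (N <= m)%N ->
     mdist (u n) (u m) <= C / N.+1%:R) ->
  cvg (u @ \oo).
Proof.
move=> uC; apply: cauchy_cvg; apply: cauchy_exP => e e0.
(* Chosen so that [C / e < N + 1]. *)
pose N := maxn N0 (Num.truncn (C / e)).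
exists (u N); rewrite ballEmdist; exists N => // n /= Nn.
apply: le_lt_trans (uC N N n _ _ Nn) _; rewrite ?leq_maxl//.
rewrite ltr_pdivrMr// mulrC -ltr_pdivrMr//.
by rewrite (lt_le_trans (truncnS_gt _))// ler_nat ltnS leq_maxr.
Qed.

Theorem corollary3p7 (R : realType) (X : completeMetricType R)
  (delta lambda M k : R) (A : set X) :
  busemann_convex X ->
  0 <= delta -> hyperbolic X delta ->
  closed A -> geodesically_convex A ->
  1 <= lambda -> 0 <= M ->
  (forall Y : metricType R,
     hyperbolic Y delta -> quasi_geodesic_triangles_slim Y lambda M) ->
  8 * lambda * M < k ->
  (exists gamma : R -> X,
     local_quasi_geodesic_ray k lambda gamma /\ ray_image gamma `<=` A) ->
  exists sigma : R -> X, geodesic_ray sigma /\ ray_image sigma `<=` A.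
Proof.
move=> busX _ hypX closedA convA lambda1 M0 slimM kM [gamma [gammaP gammaA]].
have geoX := busX.1.
have gA t : 0 <= t -> A (gamma t).
  by move=> t0; apply: gammaA; exists t; rewrite //= in_itv/= t0.
have slimX := slimM X hypX.
(* With [n + 1] in place of [n], every geodesic below has positive length. *)
have /choice[T TP] : forall n : nat, exists T, 0 <= T /\
    n.+1%:R <= mdist (gamma 0) (gamma T).
  move=> n; have [T T0 nT] := local_quasi_geodesic_unbounded
    geoX lambda1 M0 slimX kM gammaP n.+1%:R.
  by exists T.
pose L n := mdist (gamma 0) (gamma (T n)).
have /choice[g gP] : forall n, exists g, geodesic 0 (L n) g /\
    joins 0 (L n) g (gamma 0) (gamma (T n)).
  by move=> n; exact: exists_geodesic.
have nL (n : nat) : n.+1%:R <= L n := (TP n).2.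
have close (s : R) N n m : 0 <= s <= N.+1%:R -> (N <= n)%N -> (N <= m)%N ->
    mdist (g n s) (g m s) <= 4 * M * s / N.+1%:R.
  (* The [T n] need not be monotone, but the bound is symmetric in [n] and [m]. *)
  wlog TT : n m / T n <= T m => [H sN Nn Nm|].
    have [/H|/ltW/H] := leP (T n) (T m); first exact.
    by rewrite metric_sym; apply.
  move=> /andP[s0 sN] Nn Nm.
  have NL l : (N <= l)%N -> N.+1%:R <= L l.
    by move=> Nl; rewrite (le_trans _ (nL l))// ler_nat ltnS.
  have Ln0 : 0 < L n by rewrite (lt_le_trans _ (nL n)).
  have := geodesics_to_ray_close geoX lambda1 M0 slimX kM gammaP busX
    (TP n).1 TT (gP n).1 (gP n).2 (gP m).1 (gP m).2 Ln0 s0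
    (le_trans sN (NL _ Nn)) (le_trans sN (NL _ Nm)).
  move=> /le_trans; apply; apply: ler_wpM2l; first by rewrite !mulr_ge0.
  by rewrite lef_pV2 ?posrE// NL.
have gcvg s : 0 <= s -> cvg ((fun n => g n s) @ \oo).
  (* From the index [truncn s] on, [s < N + 1], so [s] is in the domain of the geodesics
     compared. *)
  move=> s0; apply: (@harmonic_cauchy_cvg _ _ _ (4 * M * s) (Num.truncn s)).
  move=> N n m sN Nn Nm; apply: close => //; rewrite s0/= ltW//.
  by rewrite -truncn_le_nat.
have largeL (s : R) : \forall n \near \oo, s <= L n.
  exists (Num.truncn s) => // n /= sn; rewrite (le_trans _ (nL n))// ltW//.
  by rewrite -truncn_le_nat.
(* Convergence is known for [s >= 0] only; the values at negative [s] are irrelevant to a ray. *)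
exists (fun s => lim ((fun n => g n s) @ \oo)); split.
  move=> s t; rewrite !in_itv/= !andbT => s0 t0.
  apply: mdist_cvg_eventually (gcvg s s0) (gcvg t t0) _.
  (* [g n] is isometric only on [[0, L n]], which eventually contains both [s] and [t]. *)
  near=> n; apply: (gP n).1.2; rewrite in_itv/= ?s0 ?t0/=;
    near: n; exact: largeL.
move=> x [s /=]; rewrite in_itv/= andbT => s0 <-.
apply: (closed_cvg A closedA _ _ (gcvg s s0)).
near=> n.
have := convA _ _ (g n @` `[0, L n]) (gA 0 (lexx 0)) (gA _ (TP n).1).
apply.
  by exists 0, (L n), (g n); split=> //; [exact: (gP n).1|exact: (gP n).2].
exists s => //=; rewrite in_itv/= s0; near: n; exact: largeL.
Unshelve. all: by end_near. Qed.
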